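(* Let $q\in\mathbb C$ with $0<|q|<1$, $m\in\mathbb N_0$, and $a,b,c,\gamma,t\in\mathbb C\setminus\{0\}$ with $|t|<1$ and $qa,\,qc,\,\frac{qab}c,\,\gamma t\notin\{q^{-k}:k\in\mathbb N_0\}$. Then the big $q$-Jacobi polynomials $P_m(x;a,b,c;q)$ satisfy $$\sum_{n=0}^\infty t^n\frac{(\gamma;q)_n}{(q;q)_n}P_m(q^{n+1}a;a,b,c;q)=q^{\binom m2}(-qc)^m\frac{(\gamma t;q)_\infty}{(t;q)_\infty}\frac{(\frac{qab}c;q)_m}{(qc;q)_m}\;{}_3\phi_3\left(q^{-m},\,\gamma,\,q^{m+1}ab;\ qa,\,\frac{qab}c,\,\gamma t;\ q,\frac{qat}c\right).$$
   Context: $\mathbb N_0=\{0,1,2,\dots\}$. $(a;q)_n=\prod_{j=0}^{n-1}(1-aq^j)$ for $n\in\mathbb N_0\cup\{\infty\}$, $(a_1,\dots,a_k;q)_n=\prod_i(a_i;q)_n$, and $${}_r\phi_s(a_1,\dots,a_r;b_1,\dots,b_s;q,w)=\sum_{k\ge0}\frac{(a_1,\dots,a_r;q)_k}{(q,b_1,\dots,b_s;q)_k}\left((-1)^kq^{\binom k2}\right)^{1+s-r}w^k .$$ The big $q$-Jacobi polynomials are $$P_m(x;a,b,c;q)={}_3\phi_2\left(q^{-m},q^{m+1}ab,x;\ qa,qc;\ q,q\right).$$ *)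

(* Defs.v *)
From HB Require Import structures.
From mathcomp Require Import all_boot all_order all_algebra.
From mathcomp Require Import all_classical all_reals all_analysis.
From mathcomp Require Import complex.

Set Implicit Arguments.
Unset Strict Implicit.
Unset Printing Implicit Defensive.

Import Order.TTheory GRing.Theory Num.Theory.
Import numFieldNormedType.Exports.

Local Open Scope classical_set_scope.
Local Open Scope ring_scope.
Local Open Scope complex_scope.

(* R[i] carries the metric topology of its modulus, as any numFieldType does;
   canonical inference does not find it on the concrete carrier R[i]. *)
HB.instance Definition _ (R : realType) :=
  NormedModule.copy R[i] ((R[i] : numFieldType)^o).

Definition qpoch (K : numFieldType) (a q : K) (n : nat) : K :=
  \prod_(j < n) (1 - a * q ^+ j).

(* (a; q)_oo *)
Definition qpoch_inf (K : numFieldType) (a q : K) : K :=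
  limn (fun n : nat => qpoch a q n).

(* (a_1, ..., a_k; q)_n for s = [:: a_1; ...; a_k]. *)
Definition qpochs (K : numFieldType) (s : seq K) (q : K) (n : nat) : K :=
  \prod_(a <- s) qpoch a q n.

(* The basic hypergeometric series r_phi_s(As; Bs; q, w), as the limit of its
   partial sums.  The exponent 1 + s - r may be negative, hence the
   integer power.  The value is meaningful only when the series converges.  *)
Definition qhyp (K : numFieldType) (As Bs : seq K) (q w : K) : K :=
  limn (series (fun k : nat =>
    qpochs As q k / qpochs (q :: Bs) q k
    * ((-1) ^+ k * q ^+ 'C(k, 2)) ^ (1 + (size Bs)%:Z - (size As)%:Z)
    * w ^+ k)).

Definition big_qJacobi (K : numFieldType) (m : nat) (x a b c q : K) : K :=
  qhyp [:: q ^- m; q ^+ m.+1 * a * b; x] [:: q * a; q * c] q q.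

(* Main.v *)
Require Import Defs.
From HB Require Import structures.
From mathcomp Require Import all_boot all_order all_algebra.
From mathcomp Require Import all_classical all_reals all_analysis.
From mathcomp Require Import complex.
From mathcomp Require Import ring lra zify.

Set Implicit Arguments.
Unset Strict Implicit.
Unset Printing Implicit Defensive.

Import Order.TTheory GRing.Theory Num.Theory.
Import numFieldNormedType.Exports.

Local Open Scope classical_set_scope.
Local Open Scope ring_scope.
Local Open Scope complex_scope.

(** Write [d = qa], [g = qab/c], [C = q^(m+1) ab]. On the lattice [x = q^(n+1) a]
the terminating series [P_m(x; a, b, c; q)] is, up to an explicit constant,
a second terminating series in which [n] occurs only through the products
[(q^n - 1) (q^n - q) ... (q^n - q^(j-1))]; this is [big_qJacobi_lattice].
It is the transformation of terminating 3phi2 series, and comes from two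
q-Chu-Vandermonde sums: one expands [(x; q)_k] in the basis
[\prod_(i < j) (x - d q^i)] ([qpoch_expansion]), the other evaluates the inner
sum that appears after the order of summation is exchanged ([q_vandermonde]).
Both are kept free of division: Gaussian binomials replace [(q^-k; q)_j], and
each proof is an induction whose step is a q-Pascal summation by parts.

The theorem then reduces to summing over [n] the q-binomial series
[F(t) = \sum_n t^n (gamma; q)_n / (q; q)_n] with each of these products as a
weight. Let [F_j(t)] be the sum weighted by [j] factors. A factor [q^n] in the
summand replaces [t] by [tq], so [F_(j+1)(t) = F_j(tq) - q^j F_j(t)]. By the functional equation
[(1 - t) F(t) = (1 - gamma t) F(tq)] the weighted sum is an explicit multiple
of [F(t)] ([qbinom_series_weighted]), and the multiples are the terms of the
3phi3 series.

The value of [F(t)] is the q-binomial theorem: iterating the functional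
equation gives [F(t) (t; q)_n = (gamma t; q)_n F(t q^n)], and [F(t q^n)] tends
to 1. The convergence of the infinite series comes from a ratio test over the
complex numbers, which also covers the infinite products, since the increments of
[(a; q)_n] satisfy a first-order recurrence with ratio tending to [q]. *)

(** * Shifted factorials and Gaussian binomials *)

(** The homogeneous form of [qpoch]: it also covers the Newton basis
[\prod_(i < n) (x - d q^i)] and the closed form in [q_vandermonde] without
inverting [x]. *)
Definition qprod (K : numFieldType) (x y q : K) (n : nat) : K :=
  \prod_(i < n) (x - y * q ^+ i).

(** The Gaussian binomial, defined by the q-Pascal recurrence so that it vanishes
for [n < k] and makes sense at roots of unity too. *)
Fixpoint qbinom (K : numFieldType) (q : K) (n k : nat) : K :=
  match n, k with
  | _, 0 => 1
  | 0, _.+1 => 0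
  | n.+1, k.+1 => qbinom q n k + q ^+ k.+1 * qbinom q n k.+1
  end.

Lemma qprod1 (K : numFieldType) (a q : K) n : qprod 1 a q n = qpoch a q n.
Proof. by []. Qed.

Lemma qprodSr (K : numFieldType) (x y q : K) n :
  qprod x y q n.+1 = qprod x y q n * (x - y * q ^+ n).
Proof. by rewrite /qprod big_ord_recr. Qed.

Lemma qprodSl (K : numFieldType) (x y q : K) n :
  qprod x y q n.+1 = (x - y) * qprod x (y * q) q n.
Proof.
rewrite /qprod big_ord_recl expr0 mulr1; congr (_ * _).
by apply: eq_bigr => i _; rewrite /= /bump add1n exprS mulrA.
Qed.

Lemma qprodD (K : numFieldType) (x y q : K) m n :
  qprod x y q (m + n) = qprod x y q m * qprod x (y * q ^+ m) q n.
Proof.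
rewrite /qprod big_split_ord /=; congr (_ * _).
by apply: eq_bigr => i _; rewrite exprD mulrA.
Qed.

Lemma qprodZ (K : numFieldType) (z x y q : K) n :
  qprod (z * x) (z * y) q n = z ^+ n * qprod x y q n.
Proof.
elim: n => [|n IH]; first by rewrite /qprod !big_ord0 mul1r.
by rewrite !qprodSr IH exprSr; ring.
Qed.

Lemma qpochSr (K : numFieldType) (a q : K) n :
  qpoch a q n.+1 = qpoch a q n * (1 - a * q ^+ n).
Proof. exact: qprodSr. Qed.

Lemma qpochSl (K : numFieldType) (a q : K) n :
  qpoch a q n.+1 = (1 - a) * qpoch (a * q) q n.
Proof. exact: qprodSl. Qed.

Lemma qpochD (K : numFieldType) (a q : K) m n :
  qpoch a q (m + n) = qpoch a q m * qpoch (a * q ^+ m) q n.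
Proof. exact: qprodD. Qed.

Lemma qpoch0 (K : numFieldType) (a q : K) : qpoch a q 0 = 1.
Proof. exact: big_ord0. Qed.

Lemma qpoch_neq0 (K : numFieldType) (a q : K) n : q != 0 ->
  (forall k, a != q ^- k) -> qpoch a q n != 0.
Proof.
move=> q0 h; rewrite /qpoch; apply/prodf_neq0 => i _.
rewrite subr_eq0; apply: contra (h i) => /eqP e; apply/eqP.
by apply: (mulIf (expf_neq0 i q0)); rewrite -e mulVf // expf_neq0.
Qed.

Lemma qbinom0 (K : numFieldType) (q : K) n : qbinom q n 0 = 1.
Proof. by case: n. Qed.

Lemma qbinomS (K : numFieldType) (q : K) n k :
  qbinom q n.+1 k.+1 = qbinom q n k + q ^+ k.+1 * qbinom q n k.+1.
Proof. by []. Qed.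

Lemma qbinom_small (K : numFieldType) (q : K) n k : (n < k)%N -> qbinom q n k = 0.
Proof.
elim: n k => [|n IH] [|k] //= nk.
by rewrite !IH ?mulr0 ?addr0 //; lia.
Qed.

Lemma qbinomnn (K : numFieldType) (q : K) n : qbinom q n n = 1.
Proof. by elim: n => // n IH; rewrite qbinomS IH qbinom_small // mulr0 addr0. Qed.

(** The dual q-Pascal recurrence; comparing it with [qbinomS] gives the absorption
identity, and it drives the reversed summation by parts. *)
Lemma qbinomSr (K : numFieldType) (q : K) n k : (k <= n)%N ->
  qbinom q n.+1 k.+1 = qbinom q n k.+1 + q ^+ (n - k) * qbinom q n k.
Proof.
elim: n k => [|n IH] [|k] kn //.
- by rewrite /= mulr0 mul1r addrC.
- rewrite qbinomS [in LHS](IH 0) // [in RHS]qbinomS !qbinom0 !subn0 !exprS.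
  by ring.
- have [kn'|kn'] := leqP k.+1 n; last first.
    have -> : k = n by move: kn kn'; lia.
    by rewrite !qbinomnn qbinom_small // subnn; ring.
  rewrite qbinomS [in LHS](IH k) // [in RHS](qbinomS q n k.+1) [in RHS](qbinomS q n k).
  rewrite [in LHS](IH k.+1) // !subSS.
  have -> : (n - k = (n - k.+1).+1)%N by lia.
  by rewrite !exprS; ring.
Qed.

Lemma qbinom_fact (K : numFieldType) (q : K) n k : (k <= n)%N ->
  qbinom q n k * (qpoch q q k * qpoch q q (n - k)) = qpoch q q n.
Proof.
elim: n k => [|n IH] [|k] kn //; rewrite ?qpoch0 ?mul1r ?subn0 ?qbinom0 ?mul1r //.
have [kn'|kn'] := leqP k.+1 n; last first.
  have -> : k = n by move: kn kn'; lia.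
  by rewrite qbinomnn subnn qpoch0 mul1r mulr1.
rewrite qbinomS subSS.
have h1 := IH _ (ltnW kn'); have h2 := IH _ kn'.
have e : (n - k = (n - k.+1).+1)%N by lia.
rewrite [RHS]qpochSr mulrDl.
rewrite (_ : 1 - q * q ^+ n = (1 - q ^+ k.+1) + q ^+ k.+1 * (1 - q ^+ (n - k))).
  rewrite mulrDr -{1}h1 -h2 qpochSr e qpochSr !exprS; ring.
rewrite mulrBr -exprD -exprS mulr1.
have -> : (k.+1 + (n - k) = n.+1)%N by lia.
by ring.
Qed.

(** q-Pascal as summation by parts: it reduces an expansion of order [n.+1] to
one of order [n] as soon as the consecutive summands have a simple
difference. *)
Lemma qbinom_sum_by_parts (K : numFieldType) (q : K) n (H : nat -> K) :
  \sum_(j < n.+2) qbinom q n.+1 j * ((-1) ^+ j * q ^+ 'C(j, 2)) * H j =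
  \sum_(j < n.+1) qbinom q n j * ((-1) ^+ j * q ^+ 'C(j, 2)) *
    (q ^+ j * (H j - H j.+1)).
Proof.
under [RHS]eq_bigr => j _ do rewrite mulrBr mulrBr.
rewrite sumrB [LHS]big_ord_recl [X in X - _]big_ord_recl big_ord_recr /=.
rewrite -!addrA; congr (_ + _); first by rewrite qbinom0; ring.
rewrite [X in _ = _ - X]big_ord_recr /= [X in X + _ = _](eq_bigr (fun j : 'I_n =>
  qbinom q n j.+1 * ((-1) ^+ j.+1 * q ^+ 'C(j.+1, 2)) *
    (q ^+ j.+1 * H j.+1) - qbinom q n j * ((-1) ^+ j * q ^+ 'C(j, 2)) *
    (q ^+ j * H j.+1))); last first.
  by move=> j _; rewrite /bump add1n !binS !bin1 !exprD !exprS; ring.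
rewrite sumrB /bump /= -!addrA; congr (_ + _).
rewrite opprD; congr (_ + _).
rewrite add1n (@qbinom_small _ q n n.+1) // !binS !bin1 !exprD !exprS; ring.
Qed.

(** The same with the signs weighted from the other end, as the second
q-Vandermonde sum requires. *)
Lemma qbinom_sum_by_parts_rev (K : numFieldType) (q : K) n (H : nat -> K) :
  \sum_(j < n.+2) qbinom q n.+1 j * ((-1) ^+ j * q ^+ 'C(n.+1 - j, 2)) * H j =
  \sum_(j < n.+1) qbinom q n j * ((-1) ^+ j * q ^+ 'C(n - j, 2)) *
    (q ^+ (n - j) * (H j - H j.+1)).
Proof.
under [RHS]eq_bigr => j _ do rewrite mulrBr mulrBr.
rewrite sumrB [LHS]big_ord_recl [X in X - _]big_ord_recl big_ord_recr /=.
rewrite -!addrA; congr (_ + _).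
  by rewrite !subn0 !qbinom0 binS bin1 exprD; ring.
rewrite [X in _ = _ - X]big_ord_recr /= [X in X + _ = _](eq_bigr (fun j : 'I_n =>
  qbinom q n j.+1 * ((-1) ^+ j.+1 * q ^+ 'C(n - j.+1, 2)) *
    (q ^+ (n - j.+1) * H j.+1) - qbinom q n j * ((-1) ^+ j * q ^+ 'C(n - j, 2)) *
    (q ^+ (n - j) * H j.+1))); last first.
  move=> j _; rewrite /bump add1n -qbinomS qbinomSr ?(ltnW (ltn_ord j)) //.
  have -> : (n - j = (n - j.+1).+1)%N by have := ltn_ord j; lia.
  have -> : (n.+1 - j.+1 = (n - j.+1).+1)%N by have := ltn_ord j; lia.
  by rewrite !binS !bin1 !exprD !exprS; ring.
rewrite sumrB /bump /= -!addrA; congr (_ + _).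
rewrite opprD; congr (_ + _).
rewrite add1n (@qbinom_small _ q n n.+1) // !subnn !exprS; ring.
Qed.

(** Newton expansion of [(x; q)_k] at the nodes [d q^i], equivalent to
q-Chu-Vandermonde for 2phi1(q^-k, d/x; d; q, xq^k). The induction
peels off [1 - x = (1 - d q^j) - (x - d q^j)], which turns the summand of order
[k] at [(xq, dq)] into a difference. *)
Lemma qpoch_expansion (K : numFieldType) (q x d : K) k :
  qpoch x q k = \sum_(j < k.+1) qbinom q k j * ((-1) ^+ j * q ^+ 'C(j, 2)) *
    (qprod x d q j * qpoch (d * q ^+ j) q (k - j)).
Proof.
elim: k x d => [|k IH] x d.
  by rewrite big_ord1 /qprod /qpoch !big_ord0 /=; ring.
rewrite (qbinom_sum_by_parts q k (fun j => qprod x d q j * qpoch (d * q ^+ j) q (k.+1 - j))).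
rewrite qpochSl (IH _ (d * q)) mulr_sumr; apply: eq_bigr => j _.
rewrite subSS -(mulrC q x) -(mulrC q d) qprodZ subSn -1?ltnS // qpochSl qprodSr.
by rewrite exprSr !mulrA -[d * q ^+ j * q]mulrA -exprSr exprS (mulrC q d) -!mulrA; ring.
Qed.

(** The other q-Chu-Vandermonde sum, 2phi1(q^-n, b; c; q, q), with denominators
cleared. The induction peels off [b - c], where
[q^i (b - c) = (1 - c q^i) - (1 - b q^i)]. *)
Lemma q_vandermonde (K : numFieldType) (q b c : K) n :
  q ^+ 'C(n, 2) * qprod b c q n =
  \sum_(i < n.+1) qbinom q n i * ((-1) ^+ i * q ^+ 'C(n - i, 2)) *
    (qpoch b q i * qpoch (c * q ^+ i) q (n - i)).
Proof.
elim: n b c => [|n IH] b c.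
  by rewrite big_ord1 /qprod /qpoch !big_ord0 /=; ring.
rewrite (qbinom_sum_by_parts_rev q n (fun i => qpoch b q i * qpoch (c * q ^+ i) q (n.+1 - i))).
rewrite qprodSl binS bin1 exprD.
rewrite [LHS](_ : _ = q ^+ n * (b - c) * (q ^+ 'C(n, 2) * qprod b (c * q) q n)); last by ring.
rewrite IH mulr_sumr; apply: eq_bigr => i _.
have ni : (i <= n)%N by rewrite -ltnS.
rewrite subSS subSn // qpochSl qpochSr.
rewrite [in q ^+ n](_ : n = (i + (n - i))%N); last by lia.
rewrite exprD -[c * q ^+ i * q]mulrA -exprSr exprS -[c * q * q ^+ i]mulrA.
by ring.
Qed.

(** * The transformation of terminating 3phi2 series *)

Lemma sum_triangle (V : nmodType) (F : nat -> nat -> V) m :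
  \sum_(k < m.+1) \sum_(j < k.+1) F k j =
  \sum_(j < m.+1) \sum_(i < (m - j).+1) F (j + i)%N j.
Proof.
under eq_bigr => k _ do rewrite (big_ord_widen m.+1 (F k) (ltn_ord k)).
rewrite (exchange_big_dep xpredT) //=; apply: eq_bigr => j _.
under eq_bigl => k do rewrite ltnS -[(_ <= _)%N]andTb.
rewrite -(big_geq_mkord j m.+1 xpredT (fun k => F k j)) -{1}[val j]add0n big_addn.
have jm : (j <= m)%N by rewrite -ltnS.
by rewrite subSn // big_mkord; apply: eq_bigr => i _; rewrite addnC.
Qed.

Lemma qbinom_trinomial (K : numFieldType) (q : K) m j i :
  (forall n, qpoch q q n != 0) -> (j + i <= m)%N ->
  qbinom q m (j + i) * qbinom q (j + i) j = qbinom q m j * qbinom q (m - j) i.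
Proof.
move=> hq jim.
apply: (mulIf (hq j)); apply: (mulIf (hq i)); apply: (mulIf (hq (m - j - i)%N)).
have h1 := qbinom_fact q jim.
have h2 := qbinom_fact q (leq_addr i j).
have h3 : (j <= m)%N by lia.
have {}h3 := qbinom_fact q h3.
have h4 : (i <= m - j)%N by lia.
have {}h4 := qbinom_fact q h4.
have e1 : (j + i - j = i)%N by lia.
have e2 : (m - (j + i) = m - j - i)%N by lia.
rewrite e1 in h2; rewrite e2 in h1.
transitivity (qpoch q q m).
  by rewrite -h1 -h2; ring.
by rewrite -h3 -h4; ring.
Qed.

(** Expand [(x; q)_k] at the nodes [d q^i], exchange the sums, and evaluate the
inner one, which by [qbinom_trinomial] is a q-Vandermonde sum of order
[m - j]. *)
Lemma qhyp32_transformation (K : numFieldType) (q C E x d : K) m :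
  (forall n, qpoch q q n != 0) -> (forall n, qpoch d q n != 0) ->
  \sum_(k < m.+1) qbinom q m k * ((-1) ^+ k * q ^+ 'C(m - k, 2)) *
     (qpoch C q k * qpoch (E * q ^+ k) q (m - k)) * (qpoch x q k / qpoch d q k) =
  \sum_(j < m.+1) qbinom q m j * (q ^+ 'C(j, 2) * q ^+ 'C(m - j, 2)) *
     (qpoch C q j * qprod x d q j / qpoch d q j) *
     qprod (C * q ^+ j) (E * q ^+ j) q (m - j).
Proof.
move=> hq hd.
under eq_bigr => k _.
  rewrite (qpoch_expansion q x d) mulr_suml mulr_sumr. over.
rewrite (sum_triangle (fun k j => qbinom q m k * ((-1) ^+ k * q ^+ 'C(m - k, 2)) *
     (qpoch C q k * qpoch (E * q ^+ k) q (m - k)) * (qbinom q k j *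
     ((-1) ^+ j * q ^+ 'C(j, 2)) * (qprod x d q j * qpoch (d * q ^+ j) q (k - j)) /
     qpoch d q k))).
apply: eq_bigr => j _.
transitivity (qbinom q m j * q ^+ 'C(j, 2) *
     (qpoch C q j * qprod x d q j / qpoch d q j) *
     (q ^+ 'C(m - j, 2) * qprod (C * q ^+ j) (E * q ^+ j) q (m - j))); last by ring.
rewrite q_vandermonde mulr_sumr; apply: eq_bigr => i _.
have jm : (j <= m)%N by rewrite -ltnS.
have jim : (j + i <= m)%N by have := ltn_ord i; lia.
have e1 : (j + i - j = i)%N by lia.
have e2 : (m - (j + i) = m - j - i)%N by lia.
have hd1 := hd j; have := hd (j + i)%N.
rewrite e1 e2 !qpochD mulf_eq0 negb_or => /andP[_ hd2].
transitivity (qbinom q m (j + i) * qbinom q (j + i) j *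
  (((-1) ^+ j) ^+ 2 * (-1) ^+ i * q ^+ 'C(m - j - i, 2) *
     (qpoch C q j * qpoch (C * q ^+ j) q i *
      qpoch (E * q ^+ j * q ^+ i) q (m - j - i)) *
     (q ^+ 'C(j, 2) * qprod x d q j) / qpoch d q j)).
  by rewrite !exprD [E * (_ * _)]mulrA; field; rewrite hd1 hd2.
rewrite qbinom_trinomial // sqrr_sign; field.
exact: hd1.
Qed.

Lemma qbinom_absorb (K : numFieldType) (q : K) m k : (k <= m)%N ->
  qbinom q m k.+1 * (1 - q ^+ k.+1) = qbinom q m k * (1 - q ^+ (m - k)).
Proof.
move=> km; have := qbinomSr q km; rewrite qbinomS => h.
apply/eqP; rewrite -subr_eq0; apply/eqP.
rewrite -[RHS](subrr (qbinom q m k.+1 + q ^+ (m - k) * qbinom q m k)) -{2}h.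
by ring.
Qed.

(** The link between the Gaussian binomial and a terminating parameter: both
sides vanish for [m < k], where the left one has the factor [q^m - q^m]. *)
Lemma qprod_qbinom (K : numFieldType) (q : K) m k :
  qprod (q ^+ m) 1 q k =
  qbinom q m k * ((-1) ^+ k * q ^+ 'C(k, 2)) * qpoch q q k.
Proof.
elim: k => [|k IH]; first by rewrite /qprod /qpoch !big_ord0 qbinom0 /=; ring.
rewrite qprodSr IH mul1r qpochSr.
have [km|km] := leqP k m; last by rewrite !qbinom_small ?mul0r // ltnW.
transitivity (- (qbinom q m k * (1 - q ^+ (m - k))) * q ^+ k
  * ((-1) ^+ k * q ^+ 'C(k, 2)) * qpoch q q k).
  have -> : q ^+ m = q ^+ (m - k) * q ^+ k by rewrite -exprD subnK.
  by ring.
by rewrite -qbinom_absorb // binS bin1 exprD !exprS; ring.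
Qed.

Lemma qpoch_Vexpr (K : numFieldType) (q : K) m k : q != 0 ->
  qpoch (q ^- m) q k * q ^+ (m * k) =
  qbinom q m k * ((-1) ^+ k * q ^+ 'C(k, 2)) * qpoch q q k.
Proof.
move=> q0; rewrite -qprod_qbinom exprM mulrC -qprod1 -qprodZ mulr1.
by rewrite mulfV // expf_neq0.
Qed.

(** Reversing the order of the factors: with [y q^n h] in the first slot each
factor is a monomial times one of [(h; q)_n]. *)
Lemma qprod_reflect (K : numFieldType) (y h q : K) n :
  qprod (y * q ^+ n * h) (y * q) q n =
  (- y) ^+ n * q ^+ ('C(n, 2) + n) * qpoch h q n.
Proof.
elim: n y => [|n IH] y; first by rewrite /qprod /qpoch !big_ord0 /=; ring.
rewrite qprodSl exprS [y * (q * _)]mulrA IH qpochSr binS bin1.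
by rewrite -[- (y * q)]mulNr exprMn !exprD !exprS; ring.
Qed.

Lemma bin2_add m n : ('C(m + n, 2) = 'C(m, 2) + 'C(n, 2) + m * n)%N.
Proof.
by elim: m => [|m IH]; [rewrite !add0n addn0 | rewrite addSn !binS !bin1 IH; lia].
Qed.

Lemma bin2_double n : ('C(n, 2) + 'C(n, 2) + n = n * n)%N.
Proof. by elim: n => // n IH; rewrite !binS !bin1; lia. Qed.

Lemma lim_series_terminating (K : numFieldType) (u : nat -> K) m :
  (forall k, (m < k)%N -> u k = 0) -> limn (series u) = \sum_(k < m.+1) u k.
Proof.
move=> h; apply: cvg_lim => //; apply: cvg_near_cst.
exists m.+1 => // n /= mn; rewrite /series /= -(big_mkord xpredT).
rewrite (big_cat_nat (leq0n _) mn) /= [X in _ + X]big_nat_cond [X in _ + X]big1 ?addr0 //.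
by move=> k /andP[/andP[mk _] _]; exact: h.
Qed.

Lemma qpoch_Vexpr_small (K : numFieldType) (q : K) m k : q != 0 -> (m < k)%N ->
  qpoch (q ^- m) q k = 0.
Proof.
move=> q0 mk; apply: (mulIf (expf_neq0 (m * k) q0)).
by rewrite mul0r qpoch_Vexpr // qbinom_small // !mul0r.
Qed.

Lemma qpochs_cons (K : numFieldType) (a q : K) (s : seq K) n :
  qpochs (a :: s) q n = qpoch a q n * qpochs s q n.
Proof. exact: big_cons. Qed.

Lemma qhyp_terminating (K : numFieldType) (q w : K) m (As Bs : seq K) : q != 0 ->
  qhyp (q ^- m :: As) Bs q w =
  \sum_(k < m.+1) (qpoch (q ^- m) q k * qpochs As q k / qpochs (q :: Bs) q k
    * ((-1) ^+ k * q ^+ 'C(k, 2)) ^ ((size Bs)%:Z - (size As)%:Z) * w ^+ k).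
Proof.
move=> q0; rewrite /qhyp (@lim_series_terminating _ _ m) => [|k mk]; last first.
  by rewrite (qpochs_cons (q ^- m)) qpoch_Vexpr_small // !mul0r.
apply: eq_bigr => k _; rewrite (qpochs_cons (q ^- m)); congr (_ * _ ^ _ * _).
by rewrite /=; lia.
Qed.

(** The [n]-independent part of the [j]-th term of
3phi2(q^-m, C, q^-n; d, g; q, q^n w): the factor [(q^-n; q)_j q^(nj)] left out is
[qprod (q ^+ n) 1 q j]. *)
Definition lattice_coef (K : numFieldType) (q C d g w : K) m j : K :=
  qpoch (q ^- m) q j * qpoch C q j / (qpoch q q j * qpoch d q j * qpoch g q j)
  * w ^+ j.

(** Clearing [q^C(m,2)] and [(qc; q)_m] puts the defining series in the shape of
[qhyp32_transformation] with [x = q^(n+1) a] and [d = qa]; the product that the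
inner sum leaves is then reversed to expose [(g; q)_m / (g; q)_j]. *)
Lemma big_qJacobi_lattice (K : numFieldType) (q : K) m n (a b c : K) :
  q != 0 -> c != 0 -> (forall n, qpoch q q n != 0) ->
  (forall n, qpoch (q * a) q n != 0) -> (forall n, qpoch (q * c) q n != 0) ->
  (forall n, qpoch (q * a * b / c) q n != 0) ->
  big_qJacobi m (q ^+ n.+1 * a) a b c q =
  q ^+ 'C(m, 2) * (- (q * c)) ^+ m
  * (qpoch (q * a * b / c) q m / qpoch (q * c) q m)
  * \sum_(j < m.+1) lattice_coef q (q ^+ m.+1 * a * b) (q * a) (q * a * b / c)
       (q * a / c) m j * qprod (q ^+ n) 1 q j.
Proof.
move=> q0 c0 hq hd hE hg; rewrite /big_qJacobi qhyp_terminating //.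
set C := q ^+ m.+1 * a * b; set g := q * a * b / c.
have qn0 k : q ^+ k != 0 by rewrite expf_neq0.
apply: (mulfI (qn0 'C(m, 2))); apply: (mulfI (hE m)).
transitivity (\sum_(k < m.+1) qbinom q m k * ((-1) ^+ k * q ^+ 'C(m - k, 2)) *
     (qpoch C q k * qpoch (q * c * q ^+ k) q (m - k)) *
     (qpoch (q ^+ n.+1 * a) q k / qpoch (q * a) q k)).
  rewrite !mulr_sumr; apply: eq_bigr => -[k km] _ /=; rewrite ltnS in km.
  rewrite !qpochs_cons /qpochs !big_nil /= subrr expr0z !mulr1.
  have := hE m; rewrite -[in qpoch (q * c) q m](subnKC km) qpochD mulf_eq0 negb_or.
  move=> /andP[hEk hEmk].
  have -> : qpoch (q ^- m) q k = qbinom q m k * ((-1) ^+ k * q ^+ 'C(k, 2)) *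
    qpoch q q k / q ^+ (m * k) by rewrite -qpoch_Vexpr // mulfK.
  (* The powers of q from the binomial exponents combine to cancel q^(mk). *)
  have e : q ^+ 'C(m, 2) * q ^+ 'C(k, 2) * q ^+ k = q ^+ 'C(m - k, 2) * q ^+ (m * k).
    rewrite -!exprD; congr (_ ^+ _); rewrite -{1 3}(subnKC km) bin2_add mulnDl.
    by have := bin2_double k; lia.
  have hqk := hq k; have hdk := hd k; have hqmk := qn0 (m * k)%N.
  rewrite [LHS](_ : _ = q ^+ 'C(m, 2) * q ^+ 'C(k, 2) * q ^+ k * (qbinom q m k * (-1) ^+ k *
     (qpoch C q k * qpoch (q * c * q ^+ k) q (m - k)) *
     (qpoch (q ^+ n.+1 * a) q k / qpoch (q * a) q k)) / q ^+ (m * k)).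
    by rewrite e; field; rewrite hdk hqmk.
  by field; rewrite hqk hdk hEk hqmk.
rewrite qhyp32_transformation // !mulr_sumr; apply: eq_bigr => -[j jm] _ /=; rewrite ltnS in jm.
have hgj := hg j; have hEm := hE m; have hdj := hd j; have hqj := hq j.
have -> : qprod (q ^+ n.+1 * a) (q * a) q j = (q * a) ^+ j * qprod (q ^+ n) 1 q j.
  by rewrite -qprodZ mulr1 exprS; congr qprod; ring.
have -> : qprod (C * q ^+ j) (q * c * q ^+ j) q (m - j) =
    (- (c * q ^+ j)) ^+ (m - j) * q ^+ ('C(m - j, 2) + (m - j)) * qpoch (g * q ^+ j) q (m - j).
  rewrite -qprod_reflect; congr qprod; last by ring.
  rewrite /C /g exprS -{1}(subnKC jm) exprD; by field.
rewrite /lattice_coef -[in qpoch g q m](subnKC jm) qpochD -[in (- (q * c)) ^+ m](subnKC jm).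
have -> : qpoch (q ^- m) q j = qbinom q m j * ((-1) ^+ j * q ^+ 'C(j, 2)) *
    qpoch q q j / q ^+ (m * j) by rewrite -qpoch_Vexpr // mulfK.
have e : q ^+ (m * j) * q ^+ (j * (m - j)) =
   q ^+ 'C(m, 2) * q ^+ 'C(m, 2) * q ^+ j / (q ^+ 'C(m - j, 2) * q ^+ 'C(m - j, 2)).
  apply: (mulIf (qn0 ('C(m - j, 2) + 'C(m - j, 2))%N)).
  rewrite [in RHS]exprD divfK ?mulf_neq0 // -!exprD; congr (_ ^+ _).
  have eC : 'C(m, 2) = ('C(j, 2) + 'C(m - j, 2) + j * (m - j))%N.
    by rewrite -bin2_add subnKC.
  have em : (m * j = j * j + j * (m - j))%N by rewrite -mulnDr subnKC // mulnC.
  by rewrite eC em -bin2_double; lia.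
have hqmj := qn0 (m * j)%N.
rewrite [LHS](_ : _ = q ^+ (m * j) * q ^+ (j * (m - j)) * (qbinom q m j * q ^+ 'C(j, 2) *
   q ^+ 'C(m - j, 2) * q ^+ 'C(m - j, 2) * q ^+ (m - j) * (qpoch C q j * qprod (q ^+ n) 1 q j /
   qpoch (q * a) q j) * (q * a) ^+ j * (-1) ^+ (m - j) * c ^+ (m - j) *
   qpoch (g * q ^+ j) q (m - j)) / q ^+ (m * j)); last first.
  by rewrite (exprNn (c * q ^+ j)) !exprMn -!exprM !exprD; field; rewrite hdj hqmj.
rewrite e !(exprNn (q * c)) !exprMn !exprVn !exprD.
set Q := q ^+ 'C(m - j, 2); set S := (-1) ^+ (m - j).
have hQ : Q != 0 by exact: qn0.
have hc : c ^+ j != 0 by exact: expf_neq0.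
rewrite -[LHS]mul1r -{1}(sqrr_sign K j); field.
by rewrite hdj hgj hqj hEm hqmj hQ hc.
Qed.
(** * Convergence of complex series *)

Lemma cvg_real_complex (R : realType) (x : nat -> R) (l : R) :
  x @ \oo --> l -> (fun n => (x n)%:C : R[i]) @ \oo --> l%:C.
Proof.
move=> xl; apply/cvgrPdist_lt => e e0.
have [er eE] : exists r : R, e = r%:C.
  by exists (complex.Re e); rewrite RRe_real // gtr0_real.
move: e0; rewrite eE ltcR => e0.
move/cvgrPdist_lt : xl => /(_ er e0); apply: filterS => n.
by rewrite -rmorphB /= normc_def /= expr0n /= addr0 sqrtr_sqr ltcR.
Qed.

Lemma ler_Re_norm (R : realType) (z : R[i]) (r : R) : `|z| <= r%:C -> `|complex.Re z| <= r.
Proof. by move=> h; rewrite -lecR; apply: le_trans h; exact: normc_ge_Re. Qed.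

Lemma ler_Im_norm (R : realType) (z : R[i]) (r : R) : `|z| <= r%:C -> `|complex.Im z| <= r.
Proof.
have := @ler_Re_norm R (z * 'i) r.
rewrite ReiNIm normrN normrM.
have -> : `|'i%C : R[i]| = 1 by rewrite normc_def /= expr0n expr1n /= add0r sqrtr1.
by rewrite mulr1.
Qed.

Lemma geometric_cvg_real (R : realType) (u : nat -> R) (M r : R) :
  0 <= M -> 0 <= r < 1 -> (forall n, `|u n| <= M * r ^+ n) -> cvgn (series u).
Proof.
move=> M0 /andP[r0 r1] h; apply: normed_cvg.
apply: (@series_le_cvg _ _ (geometric M r)) => //=.
- by move=> n; rewrite mulr_ge0 // exprn_ge0.
- by apply: is_cvg_geometric_series; rewrite ger0_norm.
Qed.

(** Convergence is transferred from the real and imaginary parts, so that only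
completeness of the reals is used. *)
Lemma geometric_cvg (R : realType) (u : nat -> R[i]) (M r : R) :
  0 <= M -> 0 <= r < 1 -> (forall n, `|u n| <= (M * r ^+ n)%:C) -> cvgn (series u).
Proof.
move=> M0 r01 h.
have hRe := geometric_cvg_real M0 r01 (fun n => ler_Re_norm (h n)).
have hIm := geometric_cvg_real M0 r01 (fun n => ler_Im_norm (h n)).
have -> : series u = (fun n => (series (fun k => complex.Re (u k)) n)%:C +
   'i%C * (series (fun k => complex.Im (u k)) n)%:C).
  apply/funext => n; rewrite /series /= !rmorph_sum mulr_sumr -big_split /=.
  by apply: eq_bigr => k _; rewrite -complexE.
apply/cvg_ex; exists ((limn (series (fun k => complex.Re (u k))))%:C +
   'i%C * (limn (series (fun k => complex.Im (u k))))%:C).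
apply: cvgD; first exact: cvg_real_complex.
apply: cvgM; first exact: cvg_cst.
exact: cvg_real_complex.
Qed.

(** The ratio test in quantitative form: the explicit geometric bound is needed
again for the uniform estimate in [qbinom_series_cvg1]. *)
Lemma ratio_geometric_bound (R : realType) (u rho : nat -> R[i]) (l : R[i]) :
  (forall n, u n.+1 = rho n * u n) -> rho @ \oo --> l -> `|l| < 1 ->
  exists M r : R, [/\ 0 <= M, 0 <= r < 1 & forall n, `|u n| <= (M * r ^+ n)%:C].
Proof.
move=> hu hrho hl.
have normE (z : R[i]) : `|z| = (complex.Re `|z|)%:C by rewrite RRe_real // normr_real.
set s := complex.Re `|l|.
have Re_norm_ge0 (z : R[i]) : 0 <= complex.Re `|z|.
  by have := normr_ge0 z; rewrite lecE => /andP[].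
have s0 : 0 <= s by exact: Re_norm_ge0.
have s1 : s < 1 by have := hl; rewrite ltcE => /andP[].
(* Any r strictly between |l| and 1 will do, and r > 0 allows dividing by r^k. *)
pose r : R := (s + 1) / 2.
have rs : s < r by rewrite /r; lra.
have r0 : 0 < r by lra.
have r1 : r < 1 by rewrite /r; lra.
have : \forall n \near \oo, `|rho n| <= r%:C.
  move/cvgrPdist_lt : hrho => /(_ (r - s)%:C).
  rewrite ltcR subr_gt0 => /(_ rs); apply: filterS => n hn.
  rewrite -(subrKC l (rho n)) (le_trans (ler_normD _ _)) // normE -/s.
  by rewrite -lerBrDl -rmorphB /= distrC ltW.
move=> [N _ hN].
(* M absorbs the terms before the ratios drop below r. *)
pose M := \sum_(k < N.+1) complex.Re `|u k| / r ^+ k.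
have M_ge0 (k : 'I_N.+1) : 0 <= complex.Re `|u k| / r ^+ k.
  apply: divr_ge0; [exact: Re_norm_ge0 | exact/exprn_ge0/ltW].
exists M, r; split; [by apply: sumr_ge0 => k _; exact: M_ge0 | by rewrite r1 ltW|].
move=> n; have [nN|Nn] := leqP n N.
  rewrite normE lecR -ler_pdivrMr ?exprn_gt0 //.
  have nN' : (n < N.+1)%N by [].
  rewrite /M (bigD1 (Ordinal nN')) //= lerDl; apply: sumr_ge0 => k _; exact: M_ge0.
elim: n Nn => // n IH Nn.
have [nN|{}Nn] := leqP n N; last first.
  rewrite hu normrM exprS mulrCA rmorphM /= ler_pM // ?IH //.
  by apply: hN; rewrite /= ltnW.
have -> : n = N by apply/eqP; rewrite eqn_leq nN -ltnS.
rewrite hu normrM exprS mulrCA rmorphM /= ler_pM //; first by apply: hN; exact: leqnn.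
rewrite normE lecR -ler_pdivrMr ?exprn_gt0 //.
rewrite /M (bigD1 ord_max) //= lerDl; apply: sumr_ge0 => k _; exact: M_ge0.
Qed.

Lemma ratio_cvg (R : realType) (u rho : nat -> R[i]) (l : R[i]) :
  (forall n, u n.+1 = rho n * u n) -> rho @ \oo --> l -> `|l| < 1 ->
  cvgn (series u).
Proof.
move=> hu hrho hl.
have [M [r [M0 r01 h]]] := ratio_geometric_bound hu hrho hl.
exact: geometric_cvg h.
Qed.

Lemma cvg_expr_complex (R : realType) (z : R[i]) : `|z| < 1 ->
  (fun n => z ^+ n) @ \oo --> (0 : R[i]).
Proof.
move=> z1; apply: cvg_series_cvg_0.
apply: (@ratio_cvg _ _ (fun _ => z) z) => //; first by move=> n; rewrite exprS.
exact: cvg_cst.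
Qed.

(** * The q-binomial theorem *)

Lemma norm_mul_expr_lt1 (R : realType) (q t : R[i]) n :
  `|q| <= 1 -> `|t| < 1 -> `|t * q ^+ n| < 1.
Proof.
move=> q1 t1; rewrite normrM normrX; apply: le_lt_trans t1.
by rewrite ler_piMr // exprn_ile1.
Qed.

Lemma subr_expr_neq0 (R : realType) (q t : R[i]) k :
  `|q| <= 1 -> `|t| < 1 -> 1 - t * q ^+ k != 0.
Proof.
move=> q1 t1; rewrite subr_eq0; apply/eqP => e.
have := norm_mul_expr_lt1 k q1 t1.
by rewrite -e normr1 ltxx.
Qed.

Lemma qpoch_neq0_norm (R : realType) (q t : R[i]) n :
  `|q| <= 1 -> `|t| < 1 -> qpoch t q n != 0.
Proof. by move=> q1 t1; apply/prodf_neq0 => k _; exact: subr_expr_neq0. Qed.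

Lemma cvg_linear_factor (R : realType) (q a : R[i]) : `|q| < 1 ->
  (fun n => 1 - a * q ^+ n) @ \oo --> (1 : R[i]).
Proof.
move=> q1; rewrite -[X in _ --> X]subr0 -[X in _ - X](mulr0 a).
apply: cvgB; first exact: cvg_cst.
by apply: cvgM; [exact: cvg_cst | exact: cvg_expr_complex].
Qed.

(** The increments [- a q^n (a; q)_n] form a series to which the ratio test
applies with limit ratio [q]. *)
Lemma qpoch_cvg (R : realType) (q a : R[i]) : `|q| < 1 ->
  (fun n => qpoch a q n) @ \oo --> qpoch_inf a q.
Proof.
move=> q1; suff : cvgn (fun n => qpoch a q n) by [].
have -> : (fun n => qpoch a q n) =
    (fun n => 1 - a * series (fun k => q ^+ k * qpoch a q k) n).
  apply/funext => n; elim: n => [|n IH].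
    by rewrite qpoch0 /series /= big_geq // mulr0 subr0.
  by rewrite seriesSr mulrDr opprD addrA -IH qpochSr; ring.
apply: is_cvgB; first exact: is_cvg_cst.
apply: is_cvgM; first exact: is_cvg_cst.
apply: (@ratio_cvg _ _ (fun n => q * (1 - a * q ^+ n)) q) => //.
  by move=> n; rewrite qpochSr exprS; ring.
rewrite -[X in _ --> X]mulr1; apply: cvgM; first exact: cvg_cst.
exact: cvg_linear_factor.
Qed.

Definition qbinom_term (K : numFieldType) (q g t : K) (n : nat) : K :=
  t ^+ n * (qpoch g q n / qpoch q q n).

Definition qbinom_series (K : numFieldType) (q g t : K) : K :=
  limn (series (qbinom_term q g t)).

Lemma qbinom_termS (R : realType) (q g t : R[i]) n : `|q| < 1 ->
  qbinom_term q g t n.+1 =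
  t * (1 - g * q ^+ n) / (1 - q * q ^+ n) * qbinom_term q g t n.
Proof.
move=> q1; rewrite /qbinom_term !qpochSr exprS.
have h1 := subr_expr_neq0 n (ltW q1) q1.
have h2 := qpoch_neq0_norm n (ltW q1) q1.
by field; rewrite h1 h2.
Qed.

Lemma qbinom_ratio_cvg (R : realType) (q g t : R[i]) : `|q| < 1 ->
  (fun n => t * (1 - g * q ^+ n) / (1 - q * q ^+ n)) @ \oo --> (t : R[i]).
Proof.
move=> q1; rewrite [X in _ --> X](_ : t = t * 1 / 1); last by rewrite divr1 mulr1.
apply: cvgM; last by apply: cvgV; [exact: oner_neq0 | exact: cvg_linear_factor].
by apply: cvgM; [exact: cvg_cst | exact: cvg_linear_factor].
Qed.

Lemma qbinom_series_cvg (R : realType) (q g t : R[i]) : `|q| < 1 -> `|t| < 1 ->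
  series (qbinom_term q g t) @ \oo --> qbinom_series q g t.
Proof.
move=> q1 t1; suff : cvgn (series (qbinom_term q g t)) by [].
exact: (ratio_cvg (fun n => qbinom_termS g t n q1) (qbinom_ratio_cvg g q1) t1).
Qed.

Lemma qbinom_term_shift (K : numFieldType) (q g t : K) n :
  qbinom_term q g (t * q) n = q ^+ n * qbinom_term q g t n.
Proof. by rewrite /qbinom_term exprMn; ring. Qed.

(** The identity [F(t) - F(tq) = t (F(t) - g F(tq))] already holds between partial
sums, with the length of the left ones shifted by 1. *)
Lemma qbinom_series_functional (R : realType) (q g t : R[i]) :
  `|q| < 1 -> `|t| < 1 ->
  (1 - t) * qbinom_series q g t = (1 - g * t) * qbinom_series q g (t * q).
Proof.
move=> q1 t1; set f := qbinom_series q g t; set fq := qbinom_series q g (t * q).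
have hf := @qbinom_series_cvg _ _ g _ q1 t1.
have hfq := @qbinom_series_cvg _ _ g _ q1 (norm_mul_expr_lt1 1 (ltW q1) t1).
suff : f - fq = t * (f - g * fq) by move=> h; apply/eqP; rewrite -subr_eq0;
  apply/eqP; rewrite -[RHS](subrr (f - fq)) {2}h; ring.
pose S s := series (qbinom_term q g s).
have e : (fun n => S t n.+1 - S (t * q) n.+1) =
    (fun n => t * (S t n - g * S (t * q) n)).
  apply/funext => n; rewrite /S; elim: n => [|n IH].
    by rewrite !seriesSr /series /= !big_geq // /qbinom_term /=; ring.
  rewrite !(seriesSr _ n.+1) opprD addrACA IH !(seriesSr _ n) !qbinom_term_shift.
  rewrite qbinom_termS // exprS.
  have h1 := subr_expr_neq0 n (ltW q1) q1.
  by field.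
have l1 : (fun n => S t n.+1 - S (t * q) n.+1) @ \oo --> f - fq.
  by apply: cvgB; [move: hf | move: hfq]; rewrite -cvg_shiftS.
have l2 : (fun n => t * (S t n - g * S (t * q) n)) @ \oo --> t * (f - g * fq).
  apply: cvgM; first exact: cvg_cst.
  apply: cvgB; first exact: hf.
  by apply: cvgM; [exact: cvg_cst | exact: hfq].
by rewrite e in l1; exact: (cvg_unique _ l1 l2).
Qed.

Lemma norm_lim_le (R : realType) (x : nat -> R[i]) (l y B : R[i]) :
  x @ \oo --> l -> B \is Num.real -> (forall n, `|x n - y| <= B) -> `|l - y| <= B.
Proof.
move=> xl Br h; rewrite real_leNgt ?normr_real //; apply/negP => lt.
move/cvgrPdist_lt : xl => /(_ (`|l - y| - B)); rewrite subr_gt0 => /(_ lt).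
move=> [N _ hN]; have := hN N (leqnn N); rewrite /= ltrBrDl => lt2.
have := le_lt_trans (lerD (h N) (lexx _)) lt2.
have := ler_normD (l - x N) (x N - y).
rewrite subrKA => le1; rewrite addrC => lt3.
by have := le_lt_trans le1 lt3; rewrite ltxx.
Qed.

(** Continuity of the series at 0 along [t q^j]: the [k]-th term carries
[q^(jk)], so all terms but the first are together at most [|q|^j] times the sum
of a geometric bound independent of [j]. *)
Lemma qbinom_series_cvg1 (R : realType) (q g t : R[i]) :
  `|q| < 1 -> `|t| < 1 ->
  (fun j => qbinom_series q g (t * q ^+ j)) @ \oo --> (1 : R[i]).
Proof.
move=> q1 t1.
have [M [r [M0 r01 hM]]] := ratio_geometric_bound
  (fun n => qbinom_termS g t n q1) (qbinom_ratio_cvg g q1) t1.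
have /andP[r0 r1] := r01.
pose B : R := M / (1 - r).
have B0 : 0 <= B by rewrite /B divr_ge0 // subr_ge0 ltW.
have bound j : `|qbinom_series q g (t * q ^+ j) - 1| <= `|q ^+ j * B%:C|.
  have tq1 := norm_mul_expr_lt1 j (ltW q1) t1.
  have := @qbinom_series_cvg _ _ g _ q1 tq1; rewrite -cvg_shiftS => hl.
  apply: (norm_lim_le hl); first exact: normr_real.
  move=> n; rewrite /series /= big_nat_recl // {1}/qbinom_term !qpoch0 expr0 invr1 !mulr1.
  rewrite addrC addKr normrM (@ger0_norm _ B%:C) ?lecR //.
  apply: (@le_trans _ _ (\sum_(0 <= k < n) `|q ^+ j| * (M * r ^+ k)%:C)); last first.
    rewrite -mulr_sumr ler_wpM2l // -rmorph_sum lecR -mulr_sumr ler_wpM2l //.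
    have := @geometric_seriesE _ 1 r; rewrite lt_eqF // => /(_ isT)/(congr1 (fun F => F n)).
    rewrite /series /=; under eq_bigr do rewrite mul1r.
    move=> ->; rewrite mul1r ler_piMl //.
      by rewrite invr_ge0 subr_ge0 ltW.
    by rewrite gerBl exprn_ge0.
  apply: le_trans (ler_norm_sum _ _ _) _; apply: ler_sum => k _.
  have -> : qbinom_term q g (t * q ^+ j) k.+1 =
      q ^+ j * (q ^+ (j * k) * qbinom_term q g t k.+1).
    by rewrite /qbinom_term exprMn -exprM mulnS exprD; ring.
  rewrite normrM ler_wpM2l // normrM.
  apply: le_trans (le_trans (hM k.+1) _); last first.
    by rewrite lecR ler_wpM2l // exprS ler_piMl ?exprn_ge0 // ltW.
  by rewrite ler_piMl // normrX exprn_ile1 // ltW.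
have h0 : (fun j => q ^+ j * B%:C) @ \oo --> (0 : R[i]).
  by rewrite -[X in _ --> X](mul0r B%:C); apply: cvgM; [exact: cvg_expr_complex | exact: cvg_cst].
apply/cvgrPdist_lt => e e0.
move/cvgr0Pnorm_lt : h0 => /(_ e e0); apply: filterS => j hj.
by rewrite distrC; exact: le_lt_trans (bound j) hj.
Qed.

Lemma qbinom_series_iter (R : realType) (q g t : R[i]) n :
  `|q| < 1 -> `|t| < 1 ->
  qbinom_series q g t * qpoch t q n =
  qpoch (g * t) q n * qbinom_series q g (t * q ^+ n).
Proof.
move=> q1 t1; elim: n => [|n IH]; first by rewrite !qpoch0 expr0 !mulr1 mul1r.
rewrite !qpochSr mulrA IH.
have tq1 := norm_mul_expr_lt1 n (ltW q1) t1.
have := qbinom_series_functional g q1 tq1.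
rewrite -[t * q ^+ n * q]mulrA -exprSr [g * (t * q ^+ n)]mulrA => h.
by rewrite -!(mulrA (qpoch _ _ _)) (mulrC _ (1 - t * _)) h.
Qed.

Lemma qbinom_series_qpoch_inf (R : realType) (q g t : R[i]) :
  `|q| < 1 -> `|t| < 1 ->
  qbinom_series q g t * qpoch_inf t q = qpoch_inf (g * t) q.
Proof.
move=> q1 t1.
have l1 : (fun n => qbinom_series q g t * qpoch t q n) @ \oo -->
    qbinom_series q g t * qpoch_inf t q.
  by apply: cvgM; [exact: cvg_cst | exact: qpoch_cvg].
have l2 : (fun n => qpoch (g * t) q n * qbinom_series q g (t * q ^+ n)) @ \oo -->
    qpoch_inf (g * t) q * 1.
  by apply: cvgM; [exact: qpoch_cvg | exact: qbinom_series_cvg1].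
have e : (fun n => qbinom_series q g t * qpoch t q n) =
  (fun n => qpoch (g * t) q n * qbinom_series q g (t * q ^+ n)).
  by apply/funext => n; exact: qbinom_series_iter.
by rewrite e mulr1 in l1 l2; exact: (cvg_unique _ l1 l2).
Qed.

(** At [g = 0] the preceding identity reads [F(t) (t; q)_oo = 1]. *)
Lemma qpoch_inf_neq0 (R : realType) (q t : R[i]) :
  `|q| < 1 -> `|t| < 1 -> qpoch_inf t q != 0.
Proof.
move=> q1 t1; have := qbinom_series_qpoch_inf 0 q1 t1.
have -> : qpoch_inf (0 * t) q = 1 :> R[i].
  rewrite /qpoch_inf; apply: cvg_lim => //.
  have -> : (fun n => qpoch (0 * t) q n) = (fun _ => 1).
    by apply/funext => n; apply: big1 => i _; rewrite !mul0r subr0.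
  exact: cvg_cst.
by move=> h; apply/eqP => h0; move: h; rewrite h0 mulr0 => /esym/eqP; rewrite oner_eq0.
Qed.

Lemma qbinom_theorem (R : realType) (q g t : R[i]) :
  `|q| < 1 -> `|t| < 1 ->
  qbinom_series q g t = qpoch_inf (g * t) q / qpoch_inf t q.
Proof.
move=> q1 t1; rewrite -(qbinom_series_qpoch_inf g q1 t1) mulfK //.
exact: qpoch_inf_neq0.
Qed.

(** Induction on [j], for all [t] at once, the sum being [F_j(t)]: multiplying the weight by [q^n - q^j]
amounts to taking [F_j(tq) - q^j F_j(t)], and the functional equation brings
[F(tq)] back to [F(t)]. *)
Lemma qbinom_series_weighted (R : realType) (q g t : R[i]) j :
  q != 0 -> `|q| < 1 -> `|t| < 1 -> (forall k, g * t != q ^- k) ->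
  series (fun n => qbinom_term q g t n * qprod (q ^+ n) 1 q j) @ \oo -->
  (-1) ^+ j * q ^+ 'C(j, 2) * t ^+ j * (qpoch g q j / qpoch (g * t) q j)
  * qbinom_series q g t.
Proof.
move=> q0 q1; elim: j t => [|j IH] t t1 ht.
  rewrite !qpoch0 /= !expr0 invr1 !mul1r.
  rewrite [X in series X](_ : _ = qbinom_term q g t); first exact: qbinom_series_cvg.
  by apply/funext => n; rewrite /qprod big_ord0 mulr1.
have htq k : g * (t * q) != q ^- k.
  apply: contra (ht k.+1) => /eqP h; apply/eqP/(mulIf q0).
  by rewrite -mulrA h exprSr invfM mulfVK.
pose u s n := qbinom_term q g s n * qprod (q ^+ n) 1 q j.
have -> : series (fun n => qbinom_term q g t n * qprod (q ^+ n) 1 q j.+1) =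
    (fun n => series (u (t * q)) n - q ^+ j * series (u t) n).
  apply/funext => n; rewrite /series /= mulr_sumr -sumrB; apply: eq_bigr => k _.
  by rewrite /u qprodSr qbinom_term_shift; ring.
have := IH _ (norm_mul_expr_lt1 1 (ltW q1) t1) htq; have := IH _ t1 ht => l1 l2.
have n0 : 1 - g * t != 0.
  by have := qpoch_neq0 1 q0 ht; rewrite qpochSr qpoch0 mul1r expr0 mulr1.
have n2 := qpoch_neq0 j q0 ht.
have n3 : 1 - g * t * q ^+ j != 0.
  by have := qpoch_neq0 j.+1 q0 ht; rewrite qpochSr mulf_eq0 negb_or => /andP[].
have ef : qbinom_series q g (t * q) = (1 - t) / (1 - g * t) * qbinom_series q g t.
  by apply: (mulfI n0); rewrite -qbinom_series_functional //; field.
have eq1 : qpoch (g * (t * q)) q j = qpoch (g * t) q j * (1 - g * t * q ^+ j) / (1 - g * t).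
  by rewrite -qpochSr qpochSl mulrA; field.
rewrite [X in _ --> X](_ : _ =
  (-1) ^+ j * q ^+ 'C(j, 2) * (t * q) ^+ j * (qpoch g q j / qpoch (g * (t * q)) q j)
  * qbinom_series q g (t * q) - q ^+ j * ((-1) ^+ j * q ^+ 'C(j, 2) * t ^+ j *
  (qpoch g q j / qpoch (g * t) q j) * qbinom_series q g t)).
  apply: cvgB; first exact: l2.
  by apply: cvgM; [exact: cvg_cst | exact: l1].
rewrite ef eq1 !qpochSr binS bin1 exprMn exprD !exprS.
by field; rewrite n0 n2 n3.
Qed.

(** * The generating function *)

Lemma cvg_series_linear_combination (R : realType) (m : nat) (w : nat -> R[i])
  (u : nat -> nat -> R[i]) (l : nat -> R[i]) :
  (forall j, series (u j) @ \oo --> l j) ->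
  series (fun n => \sum_(j < m) w j * u j n) @ \oo --> \sum_(j < m) w j * l j.
Proof.
move=> ul.
have -> : series (fun n => \sum_(j < m) w j * u j n) =
    (fun n => \sum_(j < m) w j * series (u j) n).
  apply/funext => n; rewrite /series /= exchange_big; apply: eq_bigr => j _.
  by rewrite mulr_sumr.
apply: cvg_big => [|j _]; first exact: add_continuous.
by apply: cvgM; [exact: cvg_cst | exact: ul].
Qed.

Theorem theorem8p3 (R : realType) (q : R[i]) (m : nat) (a b c gamma t : R[i])
  (q_gt0 : 0 < `|q|) (q_lt1 : `|q| < 1)
  (a_neq0 : a != 0) (b_neq0 : b != 0) (c_neq0 : c != 0)
  (gamma_neq0 : gamma != 0) (t_neq0 : t != 0) (t_lt1 : `|t| < 1)
  (hqa : forall k : nat, q * a != q ^- k)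
  (hqc : forall k : nat, q * c != q ^- k)
  (hqabc : forall k : nat, q * a * b / c != q ^- k)
  (hgammat : forall k : nat, gamma * t != q ^- k) :
  series (fun n : nat => t ^+ n * (qpoch gamma q n / qpoch q q n)
                         * big_qJacobi m (q ^+ n.+1 * a) a b c q) @ \oo -->
  q ^+ 'C(m, 2) * (- (q * c)) ^+ m
  * (qpoch_inf (gamma * t) q / qpoch_inf t q)
  * (qpoch (q * a * b / c) q m / qpoch (q * c) q m)
  * qhyp [:: q ^- m; gamma; q ^+ m.+1 * a * b]
         [:: q * a; q * a * b / c; gamma * t] q (q * a * t / c).
Proof.
have q0 : q != 0 by rewrite -normr_gt0.
have hq n : qpoch q q n != 0 by exact: qpoch_neq0_norm (ltW q_lt1) q_lt1.
have hd n := qpoch_neq0 n q0 hqa.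
have hE n := qpoch_neq0 n q0 hqc.
have hg n := qpoch_neq0 n q0 hqabc.
have hgt n := qpoch_neq0 n q0 hgammat.
pose w j := q ^+ 'C(m, 2) * (- (q * c)) ^+ m
  * (qpoch (q * a * b / c) q m / qpoch (q * c) q m) *
  lattice_coef q (q ^+ m.+1 * a * b) (q * a) (q * a * b / c) (q * a / c) m j.
pose u j n := qbinom_term q gamma t n * qprod (q ^+ n) 1 q j.
rewrite [X in series X](_ : _ = (fun n => \sum_(j < m.+1) w j * u j n)); last first.
  apply/funext => n; rewrite big_qJacobi_lattice // !mulr_sumr.
  by apply: eq_bigr => j _; rewrite /w /u /qbinom_term; ring.
have ul j := qbinom_series_weighted (j := j) q0 q_lt1 t_lt1 hgammat.
have := cvg_series_linear_combination (m := m.+1) (w := w) ul.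
suff -> : q ^+ 'C(m, 2) * (- (q * c)) ^+ m
  * (qpoch_inf (gamma * t) q / qpoch_inf t q)
  * (qpoch (q * a * b / c) q m / qpoch (q * c) q m)
  * qhyp [:: q ^- m; gamma; q ^+ m.+1 * a * b]
         [:: q * a; q * a * b / c; gamma * t] q (q * a * t / c) =
  \sum_(j < m.+1) w j * ((-1) ^+ j * q ^+ 'C(j, 2) * t ^+ j
    * (qpoch gamma q j / qpoch (gamma * t) q j) * qbinom_series q gamma t).
  by apply.
rewrite qhyp_terminating // mulr_sumr; apply: eq_bigr => j _.
rewrite !qpochs_cons /qpochs !big_nil /= qbinom_theorem // /w /lattice_coef.
rewrite (_ : (3 - 2)%Z = 1%Z) // expr1z.
have hqj := hq j; have hdj := hd j; have hgj := hg j; have hgtj := hgt j.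
have hEm := hE m; have hinf := qpoch_inf_neq0 q_lt1 t_lt1.
have cj0 : c ^+ j != 0 by rewrite expf_neq0.
rewrite !exprMn !exprVn.
by field; rewrite hqj hdj hgj hgtj hEm hinf cj0.
Qed.
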